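(* Let $\mathcal{V}$ be a Taylor variety, $\mathbb{A}\in\mathcal{V}$, and $\theta\in\mathrm{Con}(\mathbb{A})$. For every $n\ge 2$, $$[\underbrace{\theta,\dots,\theta}_{n}]_{TC}=[\underbrace{\theta,\dots,\theta}_{n}]_{H}.$$
   Context: A Taylor variety is a variety with a Taylor term: an idempotent term $t$ (i.e. $t(x,\dots,x)\approx x$) of some arity $s$ such that for each $e\in\{0,\dots,s-1\}$ the variety satisfies an identity $t(z_{e,0},\dots,z_{e,s-1})\approx t(w_{e,0},\dots,w_{e,s-1})$ with all $z_{e,j},w_{e,j}\in\{x,y\}$ and $z_{e,e}=x$, $w_{e,e}=y$, where $x,y$ are distinct variables. Identify $n$ with $\{0,\dots,n-1\}$; $2^n$ is the set of functions $f:n\to\{0,1\}$, and for $\gamma\in A^{2^n}$ write $\gamma_f$ for its value at $f$. For $i\in n$, $\epsilon\in\{0,1\}$, $\mathrm{Faces}_i^\epsilon(\gamma)\in A^{2^{n\setminus\{i\}}}$ is $g\mapsto\gamma_{g\cup\{(i,\epsilon)\}}$; for $R\subseteq A^{2^n}$, $\mathrm{Faces}_i(R)=\{\langle\mathrm{Faces}_i^0(\gamma),\mathrm{Faces}_i^1(\gamma)\rangle:\gamma\in R\}$, a binary relation on $A^{2^{n\setminus\{i\}}}$. A binary relation $E$ is quasireflexive if $\langle a,b\rangle\in E$ implies $\langle a,a\rangle,\langle b,b\rangle\in E$. An $n$-dimensional tolerance of $\mathbb{A}$ is a subset $R\subseteq A^{2^n}$ compatible with the basic operations of $\mathbb{A}$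 such that each $\mathrm{Faces}_i(R)$, $i\in n$, is quasireflexive and symmetric; it is an $n$-dimensional congruence if moreover each $\mathrm{Faces}_i(R)$ is transitive. $\mathrm{cube}_i(x,y)\in A^{2^n}$ has value $x$ at $f$ if $f_i=0$ and $y$ if $f_i=1$. For $\theta_0,\dots,\theta_{n-1}\in\mathrm{Con}(\mathbb{A})$, $M(\theta_0,\dots,\theta_{n-1})$ and $\Delta(\theta_0,\dots,\theta_{n-1})$ are respectively the least $n$-dimensional tolerance and the least $n$-dimensional congruence of $\mathbb{A}$ containing $\bigcup_{i\in n}\{\mathrm{cube}_i(x,y):\langle x,y\rangle\in\theta_i\}$. For $i\in n$, $g\in 2^{n\setminus\{i\}}$, the $(i)$-cross-section line of $\gamma$ at $g$ is $\langle\gamma_{g\cup\{(i,0)\}},\gamma_{g\cup\{(i,1)\}}\rangle$. For $\delta\in\mathrm{Con}(\mathbb{A})$, $R\subseteq A^{2^n}$ has $(\delta,i)$-centrality if there is no $\gamma\in R$ for which exactly $2^{n-1}-1$ of its $2^{n-1}$ $(i)$-cross-section lines belong to $\delta$. $[\theta_0,\dots,\theta_{n-1}]_{TC}=\bigwedge\{\delta\in\mathrm{Con}(\mathbb{A}):M(\theta_0,\dots,\theta_{n-1})\text{ has }(\delta,n-1)\text{-centrality}\}$ (term condition commutator) and $[\theta_0,\dots,\theta_{n-1}]_{H}=\bigwedge\{\delta\in\mathrm{Con}(\mathbb{A}):\Delta(\theta_0,\dots,\theta_{n-1})\text{ has }(\delta,n-1)\text{-centrality}\}$ (hypercommutator).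 *)

(* Defs.v *)
From mathcomp Require Import all_boot boolp classical_sets.
From Corelib Require Import RelationClasses Relation_Definitions.

Set Implicit Arguments.
Unset Strict Implicit.
Unset Printing Implicit Defensive.

Local Open Scope classical_set_scope.

Record signature := Signature { symbol : Type; arity : symbol -> nat }.

Record algebra (S : signature) := Algebra {
  carrier :> Type;
  interp : forall f : symbol S, ('I_(arity f) -> carrier) -> carrier }.

Inductive term (S : signature) (X : Type) : Type :=
| Var of X
| App (f : symbol S) of ('I_(arity f) -> term S X).

Arguments Var {S X} _.

Section Terms.
Variable S : signature.

Fixpoint eval (A : algebra S) (X : Type) (v : X -> A) (t : term S X) : A :=
  match t with
  | Var x => v x
  | App f args => @interp S A f (fun k => eval v (args k))
  end.

Fixpoint subst (X Y : Type) (u : X -> term S Y) (t : term S X) : term S Y :=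
  match t with
  | Var x => u x
  | App f args => @App S Y f (fun k => subst u (args k))
  end.

Definition satisfies (A : algebra S) (X : Type) (l r : term S X) : Prop :=
  forall v : X -> A, eval v l = eval v r.

Definition class_satisfies (V : set (algebra S)) (X : Type)
    (l r : term S X) : Prop :=
  forall A, V A -> satisfies A l r.

(* Identities use a countably infinite supply of variables, indexed by nat. *)
Definition variety (V : set (algebra S)) : Prop :=
  exists Sigma : set (term S nat * term S nat),
    V = [set A | forall e, Sigma e -> satisfies A e.1 e.2].

(* Identities in two variables are written with variables in bool: false stands
   for the variable x and true for the variable y. *)
Definition idempotent_term (V : set (algebra S)) (s : nat)
    (t : term S 'I_s) : Prop :=
  class_satisfies V (subst (fun _ => Var false) t) (Var false).

Definition taylor_term (V : set (algebra S)) (s : nat)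
    (t : term S 'I_s) : Prop :=
  idempotent_term V t /\
  forall e : 'I_s, exists z w : 'I_s -> bool,
    [/\ z e = false, w e = true &
        class_satisfies V (subst (fun j => Var (z j)) t)
                          (subst (fun j => Var (w j)) t)].

Definition taylor_variety (V : set (algebra S)) : Prop :=
  variety V /\ exists (s : nat) (t : term S 'I_s), taylor_term V t.

End Terms.

Section Cubes.
Variables (I : finType) (A : Type).

Definition vertex : Type := {ffun I -> bool}.

Definition cube : Type := vertex -> A.

End Cubes.

Section Faces.
Variables (I : finType) (A : Type) (i : I).

(* The index set I without i is the finite subtype {j : I | j != i}. *)
Definition others : finType := {j : I | j != i}.

(* The vertex g extended by (i, e). *)
Definition extend (e : bool) (g : vertex others) : vertex I :=
  [ffun j => if insub j is Some k then g k else e].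

Definition face (e : bool) (c : cube I A) : cube others A :=
  fun g => c (extend e g).

Definition faces (R : set (cube I A)) : relation (cube others A) :=
  fun a b => exists2 c, R c & a = face false c /\ b = face true c.

Definition cube_along (x y : A) : cube I A := fun f => if f i then y else x.

Definition centrality (delta : relation A) (R : set (cube I A)) : Prop :=
  ~ exists2 c, R c &
    #|[pred g : vertex others | `[< delta (c (extend false g))
                                          (c (extend true g)) >]]|
    = 2 ^ (#|I|.-1) - 1.

End Faces.

Arguments face {I A} i e c _.
Arguments faces {I A} i R _ _.
Arguments cube_along {I A} i x y _.
Arguments centrality {I A} i delta R.

Definition quasireflexive (T : Type) (E : relation T) : Prop :=
  forall a b, E a b -> E a a /\ E b b.

Section Commutators.
Variables (S : signature) (A : algebra S).

Definition congruence (theta : relation A) : Prop :=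
  Equivalence theta /\
  forall (f : symbol S) (a b : 'I_(arity f) -> A),
    (forall k, theta (a k) (b k)) -> theta (interp a) (interp b).

Definition compatible (I : finType) (R : set (cube I A)) : Prop :=
  forall (f : symbol S) (c : 'I_(arity f) -> cube I A),
    (forall k, R (c k)) -> R (fun v => interp (fun k => c k v)).

Definition dim_tolerance (I : finType) (R : set (cube I A)) : Prop :=
  compatible R /\
  forall i : I, quasireflexive (faces i R) /\ Symmetric (faces i R).

Definition dim_congruence (I : finType) (R : set (cube I A)) : Prop :=
  dim_tolerance R /\ forall i : I, Transitive (faces i R).

Definition generators (n : nat) (theta : 'I_n -> relation A) :
    set (cube 'I_n A) :=
  \bigcup_(i in [set: 'I_n])
    [set c | exists x y, theta i x y /\ c = cube_along i x y].

(* [smallest C G] is the intersection of all sets in C that contain G; it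
   belongs to C for both choices of C below, which are closed under
   intersections since a cube is determined by its two faces along i. *)
Definition M (n : nat) (theta : 'I_n -> relation A) : set (cube 'I_n A) :=
  smallest (@dim_tolerance 'I_n) (generators theta).

Definition Delta (n : nat) (theta : 'I_n -> relation A) : set (cube 'I_n A) :=
  smallest (@dim_congruence 'I_n) (generators theta).

(* Meets in the congruence lattice are intersections. In both commutators the
   arity is n.+1 and ord_max is the last coordinate. *)
Definition congruence_meet (D : set (relation A)) : relation A :=
  fun x y => forall delta, congruence delta -> D delta -> delta x y.

Definition tc_commutator (n : nat) (theta : 'I_n.+1 -> relation A) :
    relation A :=
  congruence_meet [set delta | centrality ord_max delta (M theta)].

Definition hypercommutator (n : nat) (theta : 'I_n.+1 -> relation A) :
    relation A :=
  congruence_meet [set delta | centrality ord_max delta (Delta theta)].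

End Commutators.

(* Main.v *)
Require Import Defs.
From mathcomp Require Import all_boot boolp classical_sets.
From Corelib Require Import RelationClasses Relation_Definitions.

Set Implicit Arguments.
Unset Strict Implicit.
Unset Printing Implicit Defensive.

Local Open Scope classical_set_scope.

(* One shows that [delta] is central for [M] iff it is central for [Delta].
   Replacing [delta] by its meet with [theta], let [R] be a tolerance between
   [M] and the cubes with values in one [theta]-block.  If [R] is
   [delta]-central in a single direction, the Taylor identities force cubes of
   [R] that agree modulo [delta] off one vertex to agree modulo [delta] there
   as well.  For such an [R], the relational composite of [R] with itself along
   any direction [j] is [delta]-central in direction [j], so the composite has
   the corner property again.  Composing repeatedly along all directions
   exhausts a congruence containing [Delta] that still has the corner property,
   which implies centrality. *)

(** * Vertices, faces, and operations on cubes *)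

Section Vertices.
Variables (I : finType) (A : Type).
Implicit Types (i j : I) (f v : vertex I) (c : cube I A) (R : set (cube I A)).

Definition setv i (e : bool) f : vertex I :=
  [ffun j => if j == i then e else f j].

Definition flipv i f : vertex I := setv i (~~ f i) f.

Definition restrictv i f : vertex (others i) := [ffun k => f (val k)].

Lemma setvE i e f j : setv i e f j = if j == i then e else f j.
Proof. by rewrite ffunE. Qed.

Lemma setv_at i e f : setv i e f i = e.
Proof. by rewrite setvE eqxx. Qed.

Lemma setv_other i e f j : j != i -> setv i e f j = f j.
Proof. by rewrite setvE => /negbTE ->. Qed.

Lemma setv_id i f : setv i (f i) f = f.
Proof. by apply/ffunP => j; rewrite setvE; case: eqP => // ->. Qed.

Lemma setv_eq i e f : f i = e -> setv i e f = f.
Proof. by move=> <-; exact: setv_id. Qed.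

Lemma setv_setv i e e' f : setv i e (setv i e' f) = setv i e f.
Proof. by apply/ffunP => j; rewrite !setvE; case: eqP. Qed.

Lemma setvC i j e e' f : i != j ->
  setv i e (setv j e' f) = setv j e' (setv i e f).
Proof.
move=> ij; apply/ffunP => k; rewrite !setvE.
by case: (eqVneq k i) => // ->; rewrite (negbTE ij).
Qed.

Lemma flipv_at i f : flipv i f i = ~~ f i.
Proof. exact: setv_at. Qed.

Lemma flipv_other i f j : j != i -> flipv i f j = f j.
Proof. exact: setv_other. Qed.

Lemma flipvK i : involutive (flipv i).
Proof. by move=> f; rewrite /flipv setv_setv setv_at negbK setv_id. Qed.

Lemma setv_flipv i e f : setv i e (flipv i f) = setv i e f.
Proof. exact: setv_setv. Qed.

Lemma flipv_setv i e f : flipv i (setv i e f) = setv i (~~ e) f.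
Proof. by rewrite /flipv setv_setv setv_at. Qed.

Lemma setv_flipvC i j e f : i != j ->
  setv i e (flipv j f) = flipv j (setv i e f).
Proof.
by move=> ij; rewrite /flipv setvC // [setv i e f j]setv_other // eq_sym.
Qed.

Lemma eq_off_direction i f v :
  (forall j, j != i -> f j = v j) -> f = v \/ f = flipv i v.
Proof.
move=> fv; have [fi|fi] := boolP (f i == v i); [left|right].
  by apply/ffunP => j; case: (eqVneq j i) => [->|/fv //]; apply/eqP.
apply/ffunP => j; case: (eqVneq j i) => [->|ji].
  by rewrite flipv_at; move: fi; case: (f i) (v i) => [] [].
by rewrite flipv_other // fv.
Qed.

Lemma extend_at i e (g : vertex (others i)) : extend e g i = e.
Proof. by rewrite ffunE; case: insubP => //= k; rewrite eqxx. Qed.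

Lemma extend_val i e (g : vertex (others i)) k : extend e g (val k) = g k.
Proof. by rewrite ffunE valK. Qed.

Lemma extend_restrictv i e f : extend e (restrictv i f) = setv i e f.
Proof.
apply/ffunP => j; rewrite setvE ffunE.
case: insubP => [k /negbTE -> <-|]; first by rewrite ffunE.
by rewrite negbK => ->.
Qed.

Lemma restrictv_extend i e (g : vertex (others i)) : restrictv i (extend e g) = g.
Proof. by apply/ffunP => k; rewrite ffunE extend_val. Qed.

Lemma setv_extend i e e' (g : vertex (others i)) :
  setv i e (extend e' g) = extend e g.
Proof. by rewrite -extend_restrictv restrictv_extend. Qed.

Lemma extend_restrictv_id i f : extend (f i) (restrictv i f) = f.
Proof. by rewrite extend_restrictv setv_id. Qed.

Lemma cube_face i c f : c f = face i (f i) c (restrictv i f).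
Proof. by rewrite /face extend_restrictv_id. Qed.

Lemma face_inj i c c' :
  face i false c = face i false c' -> face i true c = face i true c' -> c = c'.
Proof.
by move=> e0 e1; apply/funext => f; rewrite !(cube_face i); case: (f i); rewrite ?e0 ?e1.
Qed.

(** Closure under [collapse], [flip] and [glue] of matching cubes expresses quasireflexivity,
    symmetry and transitivity of [faces i R] through whole cubes, without the index type
    [others i]. *)
Definition collapse i e c : cube I A := fun f => c (setv i e f).
Definition flip i c : cube I A := fun f => c (flipv i f).
Definition glue i c c' : cube I A := fun f => if f i then c' f else c f.

Lemma face_collapse i e e' c : face i e (collapse i e' c) = face i e' c.
Proof. by apply/funext => g; rewrite /face /collapse setv_extend. Qed.

Lemma face_flip i e c : face i e (flip i c) = face i (~~ e) c.
Proof. by apply/funext => g; rewrite /face /flip /flipv extend_at setv_extend. Qed.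

Lemma face_glue i e c c' :
  face i e (glue i c c') = face i e (if e then c' else c).
Proof. by apply/funext => g; rewrite /face /glue extend_at; case: e. Qed.

Lemma collapse_face i e c f : collapse i e c f = face i e c (restrictv i f).
Proof. by rewrite /face extend_restrictv. Qed.

(** A cube is determined by its two faces, so the witness of a reflexive pair can only be
    [collapse i e c]. *)
Lemma quasireflexive_faces i R :
  quasireflexive (faces i R) <-> forall e c, R c -> R (collapse i e c).
Proof.
split=> [qr e c Rc|cl a b [c Rc [-> ->]]]; last first.
  split.
    by exists (collapse i false c); [exact: cl | rewrite !face_collapse].
  by exists (collapse i true c); [exact: cl | rewrite !face_collapse].
have [] := qr (face i false c) (face i true c); first by exists c.
move=> [c0 R0 [e00 e01]] [c1 R1 [e10 e11]].
case: e.
  by rewrite (_ : collapse _ _ _ = c1) //; apply: (@face_inj i); rewrite face_collapse.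
by rewrite (_ : collapse _ _ _ = c0) //; apply: (@face_inj i); rewrite face_collapse.
Qed.

Lemma symmetric_faces i R :
  Symmetric (faces i R) <-> forall c, R c -> R (flip i c).
Proof.
split=> [sym c Rc|cl a b [c Rc [-> ->]]]; last first.
  by exists (flip i c); [exact: cl | rewrite !face_flip].
have [|c' Rc' [e0 e1]] := sym (face i false c) (face i true c); first by exists c.
by rewrite (_ : flip _ _ = c') //; apply: (@face_inj i); rewrite face_flip.
Qed.

Lemma transitive_faces i R :
  (forall c c', R c -> R c' -> collapse i true c = collapse i false c' ->
     R (glue i c c')) ->
  Transitive (faces i R).
Proof.
move=> cl a b d [c Rc [-> ->]] [c' Rc' [e ->]].
exists (glue i c c'); last by rewrite !face_glue.
by apply: cl => //; apply/funext => f; rewrite !collapse_face e.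
Qed.

End Vertices.

(** * Tolerances and relational composition *)

Section Tolerances.
Variables (S : signature) (A : algebra S) (I : finType).
Implicit Types (i j : I) (f v : vertex I) (c P Q : cube I A).
Implicit Types R : set (cube I A).

Lemma dim_toleranceP R :
  dim_tolerance R <-> [/\ compatible R,
    forall i e c, R c -> R (collapse i e c) & forall i c, R c -> R (flip i c)].
Proof.
split=> [[comp h]|[comp hc hf]].
  split=> // i; first by have [/quasireflexive_faces] := h i.
  by have [_ /symmetric_faces] := h i.
split=> // i; split; first by apply/quasireflexive_faces => e c; exact: hc.
by apply/symmetric_faces => c; exact: hf.
Qed.

Lemma eval_compatible R (X : Type) (t : term S X) (c : X -> cube I A) :
  compatible R -> (forall x, R (c x)) -> R (fun f => eval (fun x => c x f) t).
Proof.
move=> comp Rc; elim: t => [x|s args IH] /=; last exact: comp IH.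
by rewrite (_ : (fun f => c x f) = c x) //; exact: Rc.
Qed.

(** The relation [faces j] of this set is the composite of [faces j R] with itself: the two cubes
    share the middle face. *)
Definition compose j R : set (cube I A) :=
  [set c | exists c1 c2,
    [/\ R c1, R c2, collapse j true c1 = collapse j false c2 & c = glue j c1 c2]].

Lemma sub_compose j R : dim_tolerance R -> R `<=` compose j R.
Proof.
move=> /dim_toleranceP[_ hc _] c Rc; exists (collapse j false c), c.
split=> //; [exact: hc | |].
  by apply/funext => f; rewrite /collapse setv_setv.
apply/funext => f; rewrite /glue /collapse; case fj: (f j) => //.
by rewrite -fj setv_id.
Qed.

Lemma dim_tolerance_compose j R : dim_tolerance R -> dim_tolerance (compose j R).
Proof.
move=> tolR; have sub := sub_compose j tolR.
have [comp hc hf] := (dim_toleranceP R).1 tolR.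
apply/dim_toleranceP; split.
- move=> s c /choice[c1] /choice[c2] h.
  exists (fun f => interp (fun k => c1 k f)), (fun f => interp (fun k => c2 k f)).
  split.
  + by apply: comp => k; case: (h k).
  + by apply: comp => k; case: (h k).
  + apply/funext => f; rewrite /collapse; congr interp; apply/funext => k.
    by case: (h k) => _ _ /(congr1 (@^~ f)).
  + apply/funext => f; rewrite /glue.
    by case fj: (f j); congr interp; apply/funext => k; case: (h k) => _ _ _ ->;
      rewrite /glue fj.
- move=> i e c [c1 [c2 [R1 R2 e12 ->]]]; have [->|ij] := eqVneq i j.
    apply: sub; rewrite (_ : collapse _ _ _ = collapse j e (if e then c2 else c1)).
      by apply: hc; case: e.
    by apply/funext => f; rewrite /collapse /glue setv_at; case: e.
  exists (collapse i e c1), (collapse i e c2); split; [exact: hc|exact: hc| |].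
    apply/funext => f; rewrite /collapse !(setvC _ _ _ ij).
    by move/(congr1 (@^~ (setv i e f))): e12.
  by apply/funext => f; rewrite /collapse /glue setv_other // eq_sym.
- move=> i c [c1 [c2 [R1 R2 e12 ->]]]; have [->|ij] := eqVneq i j.
    (* Reversing a composite swaps its flipped factors. *)
    exists (flip j c2), (flip j c1); split; [exact: hf|exact: hf| |].
      apply/funext => f; rewrite /collapse /flip !flipv_setv /=.
      by move/(congr1 (@^~ f)): e12.
    by apply/funext => f; rewrite /flip /glue flipv_at; case: (f j).
  have ji : j != i by rewrite eq_sym.
  exists (flip i c1), (flip i c2); split; [exact: hf|exact: hf| |].
    apply/funext => f; rewrite /collapse /flip -!setv_flipvC //.
    by move/(congr1 (@^~ (flipv i f))): e12.
  by apply/funext => f; rewrite /flip /glue flipv_other.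
Qed.

End Tolerances.

(** * Centrality and the corner property *)

Section Centrality.
Variables (I : finType) (A : Type).
Implicit Types (i j : I) (f v : vertex I) (c P Q : cube I A).
Implicit Types (R : set (cube I A)) (delta : relation A).

(** Centrality without counting: the line through [v] is the only one not assumed to lie in
    [delta]. *)
Definition line_central i delta R : Prop := forall c v, R c ->
  (forall f, f <> v -> f <> flipv i v -> delta (c f) (c (flipv i f))) ->
  delta (c v) (c (flipv i v)).

(** No direction is singled out, so this property can link centrality in one direction to centrality
    in another. *)
Definition corner_determined delta R : Prop := forall P Q v, R P -> R Q ->
  (forall f, f <> v -> delta (P f) (Q f)) -> delta (P v) (Q v).

Lemma card_lines i : #|{: vertex (others i)}| = 2 ^ #|I|.-1.
Proof.
rewrite card_ffun card_bool; congr (2 ^ _).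
rewrite card_sig -(cardC1 i); apply: eq_card => j.
by rewrite !inE.
Qed.

(** The forbidden count means exactly one line outside [delta]; symmetry is needed because [flipv]
    may traverse a line in either sense. *)
Lemma centralityP i delta R : Symmetric delta ->
  centrality i delta R <-> line_central i delta R.
Proof.
move=> sym; split=> [cen c v Rc lines|cen [c Rc]].
  apply: contrapT => bad; apply: cen; exists c => //.
  rewrite -(card_lines i) subn1 -(cardC1 (restrictv i v)); apply: eq_card => g.
  rewrite !inE; apply/asboolP/idP => [ok|/eqP gv].
    apply/eqP => gv; apply: bad; move: ok; rewrite gv !extend_restrictv /flipv.
    by case vi: (v i); rewrite /= (setv_eq vi) // => /sym.
  have neq e f : restrictv i f = restrictv i v -> extend e g <> f.
    by move=> fv gf; apply: gv; rewrite -fv -gf restrictv_extend.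
  have := lines (extend false g); rewrite /flipv extend_at setv_extend; apply.
    exact: neq.
  by apply: neq; apply/ffunP => k; rewrite !ffunE (negbTE (valP k)).
set D := (X in #|X|) => cardD.
have /eqP/cards1P[g0 Dg0] : #|[set g | ~~ D g]%SET| = 1.
  have -> : #|[set g | ~~ D g]%SET| = #|[predC D]| by apply: eq_card => g; rewrite inE.
  apply/eqP; rewrite -(eqn_add2l #|D|) cardC cardD card_lines subnK //.
  by rewrite expn_gt0.
have DE g : D g = (g != g0).
  by move/setP/(_ g): Dg0; rewrite !inE => <-; rewrite negbK.
have : D g0.
  apply/asboolP.
  have := cen c (extend false g0) Rc; rewrite /flipv extend_at setv_extend; apply.
  move=> f f0 f1; have : D (restrictv i f).
    rewrite DE; apply/eqP => fg; move: f0 f1.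
    by rewrite -fg !extend_restrictv; case fi: (f i); rewrite /= (setv_eq fi).
  move/asboolP; rewrite !extend_restrictv.
  by rewrite /flipv; case fi: (f i); rewrite /= (setv_eq fi) // => /sym.
by rewrite DE eqxx.
Qed.

(** Compare [c] with its collapse onto the face not containing [v]: they coincide on that face, and
    on the face of [v] they carry the two ends of each line. *)
Lemma corner_determined_line_central i delta R : Reflexive delta ->
  (forall e c, R c -> R (collapse i e c)) ->
  corner_determined delta R -> line_central i delta R.
Proof.
move=> refl hc cd c v Rc lines.
have cE f : f i = v i -> collapse i (~~ v i) c f = c (flipv i f).
  by rewrite /collapse /flipv => <-.
rewrite -cE //; apply: cd => //; first exact: hc.
move=> f fv; have [fi|fi] := eqVneq (f i) (v i); last first.
  rewrite /collapse setv_eq //.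
  by move: fi; case: (f i) (v i) => [] [].
rewrite cE //; apply: lines => // fE; move: fi; rewrite fE flipv_at.
by case: (v i).
Qed.

End Centrality.

(** The cubes [flip j c1] and [c2] coincide on the shared middle face and carry the two ends of the
    lines of the composite on the opposite face, where the corner property applies. *)
Lemma line_central_compose (S : signature) (A : algebra S) (I : finType) (j : I)
    (delta : relation A) (R : set (cube I A)) :
  Equivalence delta -> dim_tolerance R -> corner_determined delta R ->
  line_central j delta (compose j R).
Proof.
move=> [refl sym _] /dim_toleranceP[_ _ hf] cd c v [c1 [c2 [R1 R2 e12 ->]]] lines.
have side (f : vertex I) : f j = false -> flip j c1 f = c2 f.
  move=> fj; have /(congr1 (@^~ f)) := e12.
  by rewrite /collapse /flip /flipv fj (setv_eq fj).
have topE (f : vertex I) : f j -> flip j c1 f = glue j c1 c2 (flipv j f) /\ c2 f = glue j c1 c2 f.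
  by move=> fj; rewrite /glue /flip flipv_at fj.
have : delta (flip j c1 (setv j true v)) (c2 (setv j true v)).
  apply: cd => //; first exact: hf.
  move=> f fv; case fj: (f j); last by rewrite side.
  have [-> ->] := topE _ fj; apply: sym; apply: lines => fE; apply: fv.
    by rewrite -fE setv_eq.
  by rewrite -(setv_flipv j true v) -fE setv_eq.
have [-> ->] := topE (setv j true v) (setv_at _ _ _).
rewrite flipv_setv /flipv; case vj: (v j); rewrite (setv_eq vj) //.
exact: sym.
Qed.

(** * Evaluation of terms and Taylor identities *)

Section Terms.
Variables (S : signature) (A : algebra S).

Lemma eval_subst (X Y : Type) (u : X -> term S Y) (a : Y -> A) (t : term S X) :
  eval a (subst u t) = eval (fun x => eval a (u x)) t.
Proof.
by elim: t => //= s args IH; congr interp; apply/funext => k; exact: IH.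
Qed.

Lemma eval_congruence (delta : relation A) (X : Type) (a b : X -> A)
    (t : term S X) :
  congruence delta -> (forall x, delta (a x) (b x)) ->
  delta (eval a t) (eval b t).
Proof. by move=> [_ cong] ab; elim: t => //= s args IH; exact: cong. Qed.

Lemma idempotent_eval (V : set (algebra S)) (s : nat) (t : term S 'I_s) (a : A) :
  V A -> idempotent_term V t -> eval (fun _ => a) t = a.
Proof. by move=> VA /(_ A VA (fun _ => a)); rewrite eval_subst. Qed.

Lemma two_variable_eval (V : set (algebra S)) (s : nat) (t : term S 'I_s)
    (z w : 'I_s -> bool) (x y : A) : V A ->
  class_satisfies V (subst (fun j => Var (z j)) t) (subst (fun j => Var (w j)) t) ->
  eval (fun j => if z j then y else x) t = eval (fun j => if w j then y else x) t.
Proof.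
by move=> VA /(_ A VA (fun b => if b then y else x)); rewrite !eval_subst.
Qed.

Definition replace (s : nat) (e : 'I_s) (a : A) (u : 'I_s -> A) : 'I_s -> A :=
  fun j => if j == e then a else u j.

End Terms.

(** * From centrality in one direction to the corner property *)

Section CornerDetermined.
Variables (S : signature) (V : set (algebra S)) (s : nat) (t : term S 'I_s).
Variables (A : algebra S) (theta delta : relation A).
Hypotheses (taylor : taylor_term V t) (VA : V A).
Hypotheses (congr_theta : congruence theta) (congr_delta : congruence delta).
Hypothesis delta_theta : forall x y, delta x y -> theta x y.
Variables (I : finType) (i : I) (R : set (cube I A)).
Hypothesis tolR : dim_tolerance R.
Hypothesis genR : forall k x y, theta x y -> R (cube_along k x y).
Hypothesis blockR : forall c f g, R c -> theta (c f) (c g).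
Hypothesis cenR : line_central i delta R.
Implicit Types (e : 'I_s) (f v : vertex I) (P Q : cube I A).

(* The two sides of the Taylor identity at [e] are placed on the two ends of
   every line in direction [i], with [x], [y] the values of [P] on that line. *)
Lemma taylor_cancel_instance e P Q v : R P -> R Q ->
  (forall f, f <> v -> delta (P f) (Q f)) ->
  exists2 u : 'I_s -> A, forall j, theta (P v) (u j) &
    delta (eval (replace e (P v) u) t) (eval (replace e (Q v) u) t).
Proof.
move=> RP RQ PQ; have [_ /(_ e)[z [w [ze we identity]]]] := taylor.
have [[refl sym trans] _] := congr_delta.
have [comp hc hf] := (dim_toleranceP R).1 tolR.
(* [X] takes the end of the line on the face of [v], [Y] the other end; hence [T] is constant along
   lines. *)
pose X f := P (setv i (v i) f); pose Y f := P (setv i (~~ v i) f).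
pose T f := eval (fun j => if z j then Y f else X f) t.
have TE f : T f = eval (fun j => if w j then Y f else X f) t.
  exact: two_variable_eval identity.
have T_flip f : T (flipv i f) = T f.
  by rewrite /T /X /Y !setv_flipv.
(* Entry [e] would be [P f] on both faces, since [z e] is false and [w e] is true; it is overwritten
   by [Q f]. *)
pose C f := eval (replace e (Q f) (fun j =>
  if (if f i == v i then z j else w j) then Y f else X f)) t.
have RC : R C.
  apply: eval_compatible => // j; rewrite /replace.
  (* Each entry other than [e] is [P], its flip or one of its collapses. *)
  case: (j == e) => //; case: (z j) (w j) => [] [].
  - rewrite (_ : (fun f => _) = collapse i (~~ v i) P); first exact: hc.
    by apply/funext => f; rewrite if_same.
  - rewrite (_ : (fun f => _) = flip i P); first exact: hf.
    apply/funext => f; rewrite /flip /flipv /X /Y.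
    by case: (f i) (v i) => [] [].
  - rewrite (_ : (fun f => _) = P) //; apply/funext => f.
    by rewrite /X /Y; case fi: (f i); case: (v i); rewrite /= (setv_eq fi).
  - rewrite (_ : (fun f => _) = collapse i (v i) P); first exact: hc.
    by apply/funext => f; rewrite if_same.
have CT f : f <> v -> delta (C f) (T f).
  move=> fv; have [fi|fi] := eqVneq (f i) (v i).
    apply: eval_congruence => // j; rewrite /replace fi eqxx.
    case: eqP => [->|//]; rewrite ze /X setv_eq //.
    by apply: sym; exact: PQ.
  rewrite TE; apply: eval_congruence => // j; rewrite /replace (negbTE fi).
  case: eqP => [->|//]; rewrite we /Y setv_eq; first by apply: sym; exact: PQ.
  by case: (f i) (v i) fi => [] [].
have flip_neq : flipv i v <> v.
  by move/ffunP/(_ i); rewrite flipv_at; case: (v i).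
have CTv : delta (C v) (T v).
  apply: (trans _ (C (flipv i v))); last by rewrite -T_flip; exact: CT.
  (* Off the line of [v], both ends are [delta]-related to the common value of [T]. *)
  apply: cenR => // f fv ffv; apply: (trans _ _ _ (CT _ fv)).
  rewrite -T_flip; apply/sym/CT => fE; apply: ffv.
  by rewrite -fE flipvK.
exists (fun j => if z j then Y v else X v).
  by move=> j; case: (z j); exact: blockR.
apply: sym; move: CTv; rewrite /C eqxx; congr (delta _ _).
rewrite /T; congr (eval _ t); apply/funext => j; rewrite /replace.
by case: eqP => // ->; rewrite ze /X setv_id.
Qed.

(** At [flipv i v], which differs from [v], the cubes agree modulo [delta], hence modulo [theta];
    the [theta]-blocks carry this to [v]. *)
Lemma corner_theta P Q v : R P -> R Q ->
  (forall f, f <> v -> delta (P f) (Q f)) -> theta (P v) (Q v).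
Proof.
move=> RP RQ PQ; have [[_ _ trans] _] := congr_theta.
apply: (trans _ (P (flipv i v)) _ (blockR _ _ RP)).
apply: (trans _ (Q (flipv i v)) _ _ (blockR _ _ RQ)).
apply: delta_theta; apply: PQ.
by move/ffunP/(_ i); rewrite flipv_at; case: (v i).
Qed.

(** By idempotence [a] and [b] are values of [t] at constant tuples; changing one argument at a time
    joins them, each change being one cancellation. *)
Lemma telescope_cancel (a b : A) :
  theta a b ->
  (forall e (u : 'I_s -> A), (forall j, theta a (u j)) ->
     delta (eval (replace e a u) t) (eval (replace e b u) t)) ->
  delta a b.
Proof.
move=> ab cancel; have [[refl sym trans] _] := congr_delta.
have [[theta_refl _ _] _] := congr_theta.
have [idem _] := taylor.
pose h m := eval (fun j : 'I_s => if j < m then b else a) t.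
have hE m : m <= s -> delta a (h m).
  elim: m => [_|m IH ms].
    by rewrite /h (idempotent_eval _ VA idem); exact: refl.
  apply: (trans _ _ _ (IH (ltnW ms))); pose e := Ordinal ms.
  have := cancel e (fun j => if j < m then b else a).
  have -> : replace e a (fun j => if j < m then b else a) =
      fun j : 'I_s => if j < m then b else a.
    by apply/funext => j; rewrite /replace; case: eqP => // ->; rewrite ltnn.
  have -> : replace e b (fun j => if j < m then b else a) =
      fun j : 'I_s => if j < m.+1 then b else a.
    by apply/funext => j; rewrite /replace -(inj_eq val_inj) /= ltnS; case: ltngtP.
  by apply=> j; case: ifP.
have := hE s (leqnn s); congr (delta _ _); rewrite -[RHS](idempotent_eval _ VA idem).
by congr (eval _ t); apply/funext => j; rewrite ltn_ord.
Qed.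

(** Projection onto the subcube through [v] spanned by the directions in [J]. *)
Definition mixv (J : {set I}) v f : vertex I :=
  [ffun j => if j \in J then f j else v j].

Lemma mixv_setU1 (J : {set I}) (k : I) v f : k \notin J ->
  setv k (v k) (mixv (k |: J)%SET v f) = mixv J v f.
Proof.
move=> kJ; apply/ffunP => j; rewrite setvE !ffunE !inE.
by case: (eqVneq j k) => // ->; rewrite (negbTE kJ).
Qed.

(* The invariant is the last membership: [J] is the set of directions already
   treated. Treating [k] replaces [P] and [Q] by their images under a
   translation of [t] whose parameters move along [k] from a tuple where the
   corner values are known to be identified to an arbitrary tuple. Once [J]
   misses only [i], the cube in the hypothesis has lines joining [P] to [Q], so
   centrality of [R] applies to it. *)
Lemma corner_determined_step m (J : {set I}) P Q v : i \notin J ->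
  #|~: (i |: J)|%SET = m -> R P -> R Q ->
  (forall f, f <> v -> delta (P f) (Q f)) ->
  R (fun f => if f i then Q (mixv J v f) else P (mixv J v f)) ->
  delta (P v) (Q v).
Proof.
have [[theta_refl theta_sym theta_trans] _] := congr_theta.
have [[refl sym trans] _] := congr_delta.
have [comp hc hf] := (dim_toleranceP R).1 tolR.
elim: m J P Q => [|m IH] J P Q iJ cardJ RP RQ PQ RK.
  (* Here [mixv J v] resets only coordinate [i], so each line of the cube in [RK] joins [P] to [Q]
     at one vertex, and the line through [v] is the wanted pair. *)
  have inJ j : j != i -> j \in J.
    move=> ji; move/eqP: cardJ; rewrite cards_eq0 => /eqP/setP/(_ j).
    by rewrite !inE (negbTE ji) /= => /negbFE.
  have mix_flip f : mixv J v (flipv i f) = mixv J v f.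
    apply/ffunP => j; rewrite !ffunE; case: ifP => // jJ.
    by case: eqP jJ iJ => // -> ->.
  have mix_v : mixv J v v = v by apply/ffunP => j; rewrite ffunE if_same.
  have mix_neq f : f <> v -> f <> flipv i v -> mixv J v f <> v.
    move=> fv ffv mE; have [] // := @eq_off_direction I i f v.
    by move=> j /inJ jJ; rewrite -mE ffunE jJ.
  have := cenR (v := v) RK; rewrite mix_flip mix_v flipv_at => line_v.
  have : delta (if v i then Q v else P v) (if ~~ v i then Q v else P v).
    apply: line_v => f fv ffv; have fPQ := PQ _ (mix_neq f fv ffv).
    by rewrite mix_flip flipv_at; case: (f i) => //=; apply/sym.
  by case: (v i) => //= /sym.
have [k kJ] : exists k, k \in (~: (i |: J))%SET.
  by apply/card_gt0P; rewrite cardJ.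
move: (kJ); rewrite !inE negb_or => /andP[ki kJ'].
have Pvtheta := corner_theta RP RQ PQ.
apply: telescope_cancel => // e u uP.
have [u0 u0P cancel0] := taylor_cancel_instance e RP RQ PQ.
(* A generator along [k]: the arbitrary parameter on the face of [v], and on the opposite face the
   one for which cancellation is known. *)
pose U j f := if f k == v k then u j else u0 j.
have RU j : R (U j).
  have u0u : theta (u0 j) (u j).
    by apply: (theta_trans _ _ _ _ (uP j)); exact: theta_sym.
  case vk: (v k).
    rewrite (_ : U j = cube_along k (u0 j) (u j)); first exact: genR.
    by apply/funext => f; rewrite /U /cube_along vk; case: (f k).
  rewrite (_ : U j = cube_along k (u j) (u0 j)); first by apply: genR; exact: theta_sym.
  by apply/funext => f; rewrite /U /cube_along vk; case: (f k).
have RT c : R c -> R (fun f => eval (replace e (c f) (U^~ f)) t).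
  by move=> Rc; apply: eval_compatible => // j; rewrite /replace; case: (j == e).
(* The collapse copies the corner values to [flipv k v], where the parameters are [u0] and [cancel0]
   applies; so agreement off [v] persists. *)
pose next (c : cube I A) f := eval (replace e (collapse k (v k) c f) (U^~ f)) t.
have next_v c : next c v = eval (replace e (c v) u) t.
  rewrite /next /collapse setv_id; congr (eval _ t).
  by apply/funext => j; rewrite /replace /U eqxx.
rewrite -!next_v; apply: (IH (k |: J)%SET).
- by rewrite !inE negb_or eq_sym ki.
- have := cardsD1 k (~: (i |: J))%SET; rewrite kJ cardJ add1n => -[->].
  by apply: eq_card => j; rewrite !inE !negb_or; case: (j == k); rewrite ?andbF.
- by apply: RT; exact: hc.
- by apply: RT; exact: hc.
- move=> f fv; rewrite /next /collapse; have [fk|fk] := eqVneq (f k) (v k).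
    rewrite setv_eq //; apply: eval_congruence => // j; rewrite /replace.
    by case: eqP => // _; exact: PQ.
  have [fE|fE] := eqVneq (setv k (v k) f) v; last first.
    apply: eval_congruence => // j; rewrite /replace.
    by case: eqP => // _; apply: PQ; exact/eqP.
  rewrite fE (_ : U^~ f = u0) //.
  by apply/funext => j; rewrite /U (negbTE fk).
(* The new invariant cube is the translate of the old one: [mixv] on [k |: J] keeps coordinate [k],
   hence the parameters, and the collapse turns it into [mixv J]. *)
rewrite (_ : (fun f => _) = fun f => eval (replace e
    (if f i then Q (mixv J v f) else P (mixv J v f)) (U^~ f)) t); first exact: RT.
apply/funext => f; rewrite /next /collapse mixv_setU1 //.
have -> : U^~ (mixv (k |: J)%SET v f) = U^~ f.
  by apply/funext => j; rewrite /U ffunE !inE eqxx.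
by case: (f i).
Qed.

(** For empty [J] the invariant is the generator [cube_along i (P v) (Q v)], available because the
    corner values are [theta]-related. *)
Lemma line_central_corner_determined : corner_determined delta R.
Proof.
move=> P Q v RP RQ PQ; apply: (@corner_determined_step _ finset.set0 P Q v) => //.
  by rewrite inE.
rewrite (_ : (fun f => _) = cube_along i (P v) (Q v)).
  by apply: genR; exact: corner_theta.
apply/funext => f; rewrite /cube_along (_ : mixv _ _ _ = v) //.
by apply/ffunP => j; rewrite ffunE inE.
Qed.

End CornerDetermined.

(** * Iterated composition up to a congruence *)

Section Iteration.
Variables (S : signature) (V : set (algebra S)) (s : nat) (t : term S 'I_s).
Variables (A : algebra S) (theta delta : relation A) (n : nat).
Hypotheses (taylor : taylor_term V t) (VA : V A).
Hypotheses (congr_theta : congruence theta) (congr_delta : congruence delta).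
Hypothesis delta_theta : forall x y, delta x y -> theta x y.
Let gens := generators (fun _ : 'I_n.+1 => theta).
Let block : set (cube 'I_n.+1 A) := [set c | forall f g, theta (c f) (c g)].

Lemma gens_cube_along k x y : theta x y -> gens (cube_along k x y).
Proof. by move=> xy; exists k => //; exists x, y. Qed.

Lemma dim_tolerance_block : dim_tolerance block.
Proof.
have [_ comp] := congr_theta; apply/dim_toleranceP; split=> [f c bc g h|i e c bc f g|i c bc f g].
- by apply: comp => k; exact: bc.
- exact: bc.
- exact: bc.
Qed.

Lemma gens_block : gens `<=` block.
Proof.
have [[refl sym _] _] := congr_theta.
move=> c [k _ [x [y [xy ->]]]] f g; rewrite /cube_along.
by case: (f k); case: (g k) => //; exact: sym.
Qed.

Lemma dim_tolerance_M : dim_tolerance (M (fun _ : 'I_n.+1 => theta)).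
Proof.
apply/dim_toleranceP; split.
- move=> f c Mc R [tolR gR]; have [comp _ _] := (dim_toleranceP R).1 tolR.
  by apply: comp => k; apply: Mc.
- move=> i e c Mc R [tolR gR]; have [_ hc _] := (dim_toleranceP R).1 tolR.
  by apply: hc; apply: Mc.
- move=> i c Mc R [tolR gR]; have [_ _ hf] := (dim_toleranceP R).1 tolR.
  by apply: hf; apply: Mc.
Qed.

(** The invariant of the iteration; [gens] and [block] are the bounds used in passing from
    centrality to the corner property. *)
Definition good (R : set (cube 'I_n.+1 A)) : Prop :=
  [/\ dim_tolerance R, gens `<=` R, R `<=` block & corner_determined delta R].

Lemma good_of_line_central i R : dim_tolerance R -> gens `<=` R -> R `<=` block ->
  line_central i delta R -> good R.
Proof.
move=> tolR gR Rb cenR; split=> //.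
apply: (line_central_corner_determined taylor VA congr_theta congr_delta
  delta_theta tolR _ _ cenR) => [k x y xy|c f g /Rb].
  by apply: gR; exact: gens_cube_along.
exact.
Qed.

(** The composite is central in direction [j], and this single direction restores the corner
    property. *)
Lemma good_compose j R : good R -> good (compose j R).
Proof.
move=> [tolR gR Rb cdR]; apply: (@good_of_line_central j).
- exact: dim_tolerance_compose.
- by move=> c /gR; exact: sub_compose.
- have [[_ _ trans] _] := congr_theta.
  move=> c [c1 [c2 [/Rb b1 /Rb b2 e12 ->]]].
  (* The shared middle face puts both factors in one [theta]-block. *)
  have b12 f g : theta (c1 f) (c2 g).
    apply: (trans _ (collapse j true c1 f)); first exact: b1.
    by rewrite e12; exact: b2.
  have [[_ sym _] _] := congr_theta.
  move=> f g; rewrite /glue; case: (f j); case: (g j) => //.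
  by apply: sym.
- by apply: line_central_compose => //; case: congr_delta.
Qed.

Variable R0 : set (cube 'I_n.+1 A).
Hypothesis goodR0 : good R0.

(* The direction of composition cycles through all of ['I_n.+1], so that the
   union of the chain is transitive in every direction. *)
Fixpoint chain (m : nat) : set (cube 'I_n.+1 A) :=
  if m is m'.+1 then compose (inord (m' %% n.+1)) (chain m') else R0.

Lemma good_chain m : good (chain m).
Proof. by elim: m => [//|m IH]; exact: good_compose. Qed.

Lemma chain_sub m p : m <= p -> chain m `<=` chain p.
Proof.
elim: p => [|p IH]; first by rewrite leqn0 => /eqP ->.
rewrite leq_eqVlt => /predU1P[-> //|/IH sub] c /sub.
by apply: sub_compose; case: (good_chain p).
Qed.

Definition chain_union : set (cube 'I_n.+1 A) := [set c | exists m, chain m c].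

Lemma dim_congruence_chain_union : dim_congruence chain_union.
Proof.
split.
  apply/dim_toleranceP; split.
  - move=> f c /choice[m cm]; exists (\max_k m k).
    have [/dim_toleranceP[comp _ _] _ _ _] := good_chain (\max_k m k).
    by apply: comp => k; exact: chain_sub (leq_bigmax k) _ (cm k).
  - move=> i e c [m cm]; exists m.
    by have [/dim_toleranceP[_ hc _] _ _ _] := good_chain m; exact: hc.
  - move=> i c [m cm]; exists m.
    by have [/dim_toleranceP[_ _ hf] _ _ _] := good_chain m; exact: hf.
move=> i; apply: transitive_faces => c c' [m cm] [m' cm'] e.
(* [p] is at least both stages and congruent to [i] modulo [n.+1], so the next stage composes along
   [i]. *)
pose p := maxn m m' * n.+1 + i; exists p.+1.
have max_p : maxn m m' <= p by rewrite /p; apply: leq_trans (leq_addr _ _); exact: leq_pmulr.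
rewrite /= (_ : inord _ = i); last first.
  by apply: val_inj; rewrite /= /p modnMDl modn_small ?inordK.
exists c, c'; split=> //.
  by apply: chain_sub cm; exact: leq_trans (leq_maxl _ _) max_p.
by apply: chain_sub cm'; exact: leq_trans (leq_maxr _ _) max_p.
Qed.

Lemma good_chain_union : good chain_union.
Proof.
split; first by case: dim_congruence_chain_union.
- by move=> c gc; exists 0; case: goodR0 => _ gR _ _; exact: gR.
- by move=> c [m cm]; have [_ _ Rb _] := good_chain m; exact: Rb.
move=> P Q v [m Pm] [p Qp]; have [_ _ _] := good_chain (maxn m p); apply.
  by apply: chain_sub Pm; exact: leq_maxl.
by apply: chain_sub Qp; exact: leq_maxr.
Qed.

Lemma Delta_sub_chain_union :
  Delta (fun _ : 'I_n.+1 => theta) `<=` chain_union.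
Proof.
move=> c; apply; split; first exact: dim_congruence_chain_union.
by case: good_chain_union.
Qed.

End Iteration.

(** * Equality of the two commutators *)

Lemma centrality_M_Delta (S : signature) (V : set (algebra S)) (A : algebra S)
    (theta delta : relation A) (n : nat) :
  taylor_variety V -> V A -> congruence theta -> congruence delta ->
  centrality ord_max delta (M (fun _ : 'I_n.+1 => theta)) <->
  centrality ord_max delta (Delta (fun _ : 'I_n.+1 => theta)).
Proof.
move=> [_ [s [t taylor]]] VA cth cde.
have [[threfl thsym thtrans] thcomp] := cth.
have [[derefl desym detrans] decomp] := cde.
rewrite !centralityP //; split=> cen; last first.
  (* Congruences are tolerances, so [M] lies in [Delta] and inherits its centrality. *)
  move=> c v Mc; apply: cen => R [[tolR _] gR]; exact: Mc.
(* Centrality of [M] passes to the meet with [theta] because each cube of [M] stays in one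
   [theta]-block. *)
pose delta' x y := delta x y /\ theta x y.
have cde' : congruence delta'.
  split; first split.
  - by move=> x; split; [exact: derefl|exact: threfl].
  - by move=> x y [xy xy']; split; [exact: desym|exact: thsym].
  - by move=> x y z [xy xy'] [yz yz']; split; [exact: detrans yz|exact: thtrans yz'].
  - move=> f a b ab; split; [apply: decomp => k|apply: thcomp => k]; by case: (ab k).
have Mblock c : M (fun _ : 'I_n.+1 => theta) c -> forall f g, theta (c f) (c g).
  move=> /(_ [set c | forall f g, theta (c f) (c g)]); apply; split.
    exact: dim_tolerance_block.
  exact: gens_block.
have cen' : line_central ord_max delta' (M (fun _ : 'I_n.+1 => theta)).
  move=> c v Mc lines; split; last exact: Mblock.
  by apply: cen => // f fv ffv; case: (lines f fv ffv).
have delta'_theta x y : delta' x y -> theta x y by case.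
have goodM : good theta delta' (M (fun _ : 'I_n.+1 => theta)).
  apply: (good_of_line_central taylor VA cth cde' delta'_theta _ _ _ cen') => //.
    exact: dim_tolerance_M.
  by move=> c gc R [_]; exact.
have sub := Delta_sub_chain_union taylor VA cth cde' delta'_theta goodM.
have [tolU _ Ublock cdU] :=
  good_chain_union taylor VA cth cde' delta'_theta goodM.
have [_ hc _] := (dim_toleranceP _).1 tolU.
have refl' : Reflexive delta' by case: cde' => [[]].
move=> c v /sub Uc lines.
have [] // := corner_determined_line_central refl' (hc ord_max) cdU (v := v) Uc.
(* Cubes of the union also stay in one [theta]-block, so their lines in [delta] lie in [delta']. *)
by move=> f fv ffv; split; [exact: lines|exact: Ublock].
Qed.

Theorem theorem4p9 (Sg : signature) (V : set (algebra Sg)) (A : algebra Sg)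
    (theta : relation A) (n : nat) :
  taylor_variety V -> V A -> congruence theta -> 2 <= n.+1 ->
  tc_commutator (fun _ : 'I_n.+1 => theta) =
  hypercommutator (fun _ : 'I_n.+1 => theta).
Proof.
move=> taylor VA cth _; apply/funext => x; apply/funext => y; apply/propext.
by split=> h delta cde cen; apply: h => //;
  apply/(centrality_M_Delta _ taylor VA cth cde).
Qed.
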